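(* Let $\mathbb{K}\subset\mathbb{R}^n$ be a regular cone, let $c_1,c_2\in\mathbb{R}^n$ and $c_{1,0},c_{2,0}\in\{0,\pm1\}$, and let $C_i:=\{x\in\mathbb{K}:\ c_i^\top x\ge c_{i,0}\}$ for $i\in\{1,2\}$. Suppose that $C_1\not\subseteq C_2$, $C_2\not\subseteq C_1$, and $C_i\cap\operatorname{int}\mathbb{K}\ne\emptyset$ for $i\in\{1,2\}$. Then, up to positive scaling, any undominated valid linear inequality for $\overline{\mathrm{conv}}(C_1\cup C_2)$ has the form $\mu^\top x\ge\min\{c_{1,0},c_{2,0}\}$, where there exist $\alpha_1,\alpha_2,\beta_1,\beta_2$ such that $$\mu=\alpha_1+\beta_1c_1,\qquad \mu=\alpha_2+\beta_2c_2,$$ $$\min\{\beta_1c_{1,0},\beta_2c_{2,0}\}=\min\{c_{1,0},c_{2,0}\},$$ $$\alpha_1,\alpha_2\in\operatorname{bd}\mathbb{K}^*,\qquad \beta_1,\beta_2\in\mathbb{R}_+\setminus\{0\}.$$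
   Context: A regular cone is a full-dimensional, closed, convex, pointed cone. $\mathbb{K}^*:=\{y\in\mathbb{R}^n: y^\top x\ge0\ \forall x\in\mathbb{K}\}$ is the dual cone. $\operatorname{int}$, $\operatorname{bd}$ denote interior and boundary, and $\overline{\mathrm{conv}}$ the closed convex hull. A linear inequality $\mu^\top x\ge\mu_0$ is valid for a set if it holds at all its points. A valid linear inequality $\mu^\top x\ge\mu_0$ for $\overline{\mathrm{conv}}(C_1\cup C_2)$, with $(\mu,\mu_0)\ne(0,0)$, is undominated if there is no valid linear inequality $\nu^\top x\ge\nu_0$ for $\overline{\mathrm{conv}}(C_1\cup C_2)$ with $(\mu-\nu,\mu_0-\nu_0)\in\big(\mathbb{K}^*\times(-\mathbb{R}_+)\big)\setminus\{(0,0)\}$. ''Up to positive scaling'' means after multiplying the pair $(\mu,\mu_0)$ by a suitable positive scalar. *)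

(* Defs.v *)
From HB Require Import structures.
From mathcomp Require Import all_boot all_order all_algebra.
From mathcomp Require Import all_classical all_reals all_analysis.

Set Implicit Arguments.
Unset Strict Implicit.
Unset Printing Implicit Defensive.

Import Order.TTheory GRing.Theory Num.Theory.
Import numFieldNormedType.Exports.

Local Open Scope classical_set_scope.
Local Open Scope ring_scope.

Definition dot (R : realType) (n : nat) (y x : 'cV[R]_n) : R :=
  (y^T *m x) ord0 ord0.

(* Full-dimensionality is rendered as nonempty interior; the topology on
   'cV[R]_n is the usual one, given by the entrywise maximum norm. *)
Definition regular_cone (R : realType) (n : nat) (K : set 'cV[R]_n) : Prop :=
  [/\ forall (t : R) (x : 'cV[R]_n), 0 <= t -> K x -> K (t *: x),
      interior K !=set0,
      closed K,
      @convex_set R 'cV[R]_n K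
    & forall x : 'cV[R]_n, K x -> K (- x) -> x = 0].

Definition dual_cone (R : realType) (n : nat) (K : set 'cV[R]_n) :
    set 'cV[R]_n :=
  [set y | forall x, K x -> 0 <= dot y x].

Definition boundary (T : topologicalType) (A : set T) : set T :=
  closure A `\` interior A.

Definition closed_convex_hull (R : realType) (n : nat) (A : set 'cV[R]_n) :
    set 'cV[R]_n :=
  closure (smallest (@convex_set R 'cV[R]_n) A).

Definition cone_halfspace (R : realType) (n : nat) (K : set 'cV[R]_n)
    (c : 'cV[R]_n) (c0 : R) : set 'cV[R]_n :=
  [set x | K x /\ dot c x >= c0].

Definition valid_ineq (R : realType) (n : nat) (S : set 'cV[R]_n)
    (mu : 'cV[R]_n) (mu0 : R) : Prop :=
  forall x, S x -> dot mu x >= mu0.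

(* The dominating inequality (nu, nu0) may be the trivial one (0, 0). *)
Definition undominated (R : realType) (n : nat) (K S : set 'cV[R]_n)
    (mu : 'cV[R]_n) (mu0 : R) : Prop :=
  [/\ valid_ineq S mu mu0,
      (mu, mu0) <> (0, 0)
    & ~ exists (nu : 'cV[R]_n) (nu0 : R),
        valid_ineq S nu nu0 /\
        ((dual_cone K `*` [set r : R | r <= 0]) `\ (0, 0))
          (mu - nu, mu0 - nu0)].

(* Main.v *)
Require Import Defs.
From HB Require Import structures.
From mathcomp Require Import all_boot all_order all_algebra.
From mathcomp Require Import all_classical all_reals all_analysis.
From mathcomp Require Import ring lra.

Set Implicit Arguments.
Unset Strict Implicit.
Unset Printing Implicit Defensive.

Import Order.TTheory GRing.Theory Num.Theory.
Import numFieldNormedType.Exports.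

Local Open Scope classical_set_scope.
Local Open Scope ring_scope.

(** Farkas multipliers turn the claim about inequalities into one about
    certificates. By Lagrange duality with a single constraint, validity of
    (mu, mu0) on C_i = K /\ {c_i >= c_i0} means that some b_i >= 0 satisfies
    mu - b_i c_i \in K^* and mu0 <= b_i c_i0 ([valid_multiplier],
    [multiplier_valid]). The Slater condition holds because C_i meets the
    interior of K and c_i <> 0; with c_i = 0, the set C_i would be all of K and
    contain the other one. So an undominated (mu, mu0) is a pair that no other
    certified pair improves ([unimprovable]), and everything follows by
    exhibiting improvements:

    - if some b_i were 0, then mu \in K^* and mu0 <= 0, so (0, 0) would be at
      least as good ([unimprovable_multiplier_gt0]);
    - if mu0 < min (b_1 c_10, b_2 c_20), raising mu0 to this minimum would be
      an improvement ([unimprovable_rhs]).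

    The delicate point is that a_i = mu - b_i c_i can be taken on the boundary
    of K^*. This may fail for the given multipliers, and b_i may have to be
    changed ([boundary_multiplier]). Suppose a_1 is interior. If a_2 <> 0, then
    mu - s a_2 is still certified for small s > 0, and it improves mu. If
    a_2 = 0, then mu = b_2 c_2 and a_1 = b_2 c_2 - b_1 c_1 \in K^*, so
    b_2 c_20 <= b_1 c_10 would give C_1 `<=` C_2; hence the minimum is b_1 c_10
    alone. Moving b_1 slightly in the direction of the sign of c_10 then
    increases mu0, unless c_10 = 0; and in that case b_1 can grow without
    affecting mu0 until mu - b_1 c_1 leaves the interior of K^*
    ([boundary_crossing]).

    The normalization only uses that c_10 and c_20 are their own signs: with
    b_1, b_2 > 0, the sign of mu0 = min (b_1 c_10, b_2 c_20) is
    min (c_10, c_20), and t mu0 is that sign for t = 1 / |mu0|, or for any t if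
    mu0 = 0. *)

(** * Signs and minima *)

Lemma le_sgr (R : realDomainType) (x y : R) : x <= y -> Num.sg x <= Num.sg y.
Proof. by move=> xy; case: (sgrP x); case: (sgrP y) => //; lra. Qed.

Lemma sgr_min (R : realDomainType) (x y : R) :
  Num.sg (Num.min x y) = Num.min (Num.sg x) (Num.sg y).
Proof.
have [xy|/ltW yx] := leP x y; first by rewrite min_l ?le_sgr.
by rewrite min_r ?le_sgr.
Qed.

(** * The scalar product and closed convex hulls *)

Section Dot.
Variables (R : realType) (n : nat).
Implicit Types (x y z : 'cV[R]_n) (t : R).

Lemma dotDl y z x : dot (y + z) x = dot y x + dot z x.
Proof. by rewrite /dot linearD mulmxDl mxE. Qed.

Lemma dotZl t y x : dot (t *: y) x = t * dot y x.
Proof. by rewrite /dot linearZ -scalemxAl mxE. Qed.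

Lemma dotBl y z x : dot (y - z) x = dot y x - dot z x.
Proof. by rewrite -scaleN1r dotDl dotZl mulN1r. Qed.

Lemma dot0l x : dot 0 x = 0.
Proof. by rewrite -(scale0r 0) dotZl mul0r. Qed.

Lemma dotDr y x z : dot y (x + z) = dot y x + dot y z.
Proof. by rewrite /dot mulmxDr mxE. Qed.

Lemma dotZr t y x : dot y (t *: x) = t * dot y x.
Proof. by rewrite /dot -scalemxAr mxE. Qed.

Lemma dot0r y : dot y 0 = 0.
Proof. by rewrite -(scale0r 0) dotZr mul0r. Qed.

Lemma dotE y x : dot y x = \sum_i y i ord0 * x i ord0.
Proof. by rewrite /dot mxE; apply: eq_bigr => i _; rewrite mxE. Qed.

Lemma dotxx_gt0 y : y != 0 -> 0 < dot y y.
Proof.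
move=> y0; have le0 i : true -> 0 <= y i ord0 * y i ord0.
  by move=> _; rewrite -expr2 sqr_ge0.
rewrite dotE lt_neqAle sumr_ge0 // andbT eq_sym; apply: contra y0.
move=> /eqP /(psumr_eq0P le0) y0; apply/eqP/colP => i; rewrite mxE.
by apply/eqP; rewrite -sqrf_eq0 expr2 y0.
Qed.

Lemma dot_continuous y : continuous (dot y : 'cV[R]_n -> R).
Proof.
rewrite (_ : dot y = fun x => \sum_i y i ord0 * x i ord0); last first.
  by apply/funext => x; rewrite dotE.
apply: continuous_big => [|i _ x]; first exact: add_continuous.
apply: (continuous_comp (f := fun z : 'cV[R]_n => z i ord0)).
  exact: coord_continuous.
exact: mulrl_continuous.
Qed.

Lemma closed_halfspace y t : closed [set x | t <= dot y x].
Proof.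
by apply: (closed_comp _ (@closed_ge R t)) => x _; exact: dot_continuous.
Qed.

Lemma convex_halfspace y t :
  @convex_set R 'cV[R]_n [set x | t <= dot y x].
Proof.
move=> x z l; rewrite !inE /= => tx tz.
have -> : conv l x z = l%:num *: (x : 'cV_n) + (1 - l%:num) *: (z : 'cV_n) by [].
rewrite dotDr !dotZr.
have l0 : 0 <= l%:num by [].
have l1 : l%:num <= 1 by [].
nra.
Qed.

(** A closed halfspace is closed and convex, so it contains the closed convex
    hull of any set that it contains. *)
Lemma valid_closed_convex_hull (A : set 'cV[R]_n) y t :
  valid_ineq (closed_convex_hull A) y t <-> valid_ineq A y t.
Proof.
split=> valid x; first move=> Ax.
  by apply: valid; apply: subset_closure; apply: sub_gen_smallest.
have sub : smallest (@convex_set R 'cV[R]_n) A `<=` [set z | t <= dot y z].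
  by apply: smallest_sub => //; exact: convex_halfspace.
move=> /(closure_subset sub); rewrite -(closure_id _).1 //.
exact: closed_halfspace.
Qed.

End Dot.

(** * Interior points *)

(** Continuity of s |-> x + s v at 0. This is the form in which interiority
    enters the construction of improvements. *)
Lemma interior_ray (R : realType) (V : normedModType R) (A : set V) (x v : V) :
  interior A x -> \forall s \near 0^'+, A (x + s *: v).
Proof.
move=> Ax; have cv : x + s *: v @[s --> (0 : R)] --> x.
  rewrite -[X in _ --> X]addr0 -[X in _ --> _ + X](scale0r v).
  exact: (cvgD (cvg_cst _) (@scalel_continuous _ _ v (0 : R))).
exact: (cvg_at_right_filter cv Ax).
Qed.

Lemma interior_scale (R : realType) (V : normedModType R) (A : set V) t :
  (forall x, A (t *: x) -> A x) -> forall x, interior A (t *: x) -> interior A x.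
Proof.
move=> At x Atx.
have Ax : nbhs x ((fun y => t *: y) @^-1` A) := @scaler_continuous R V t x A Atx.
apply: filterS Ax => y; exact: At.
Qed.

(** * Regular cones and their duals *)

Section Cone.
Variables (R : realType) (n : nat) (K : set 'cV[R]_n).
Implicit Types (a x y : 'cV[R]_n) (t b : R).

Lemma regular_coneZ : regular_cone K -> forall t x, 0 <= t -> K x -> K (t *: x).
Proof. by case. Qed.

(** The sum is twice the midpoint. *)
Lemma regular_coneD : regular_cone K -> forall x y, K x -> K y -> K (x + y).
Proof.
case=> KZ _ _ Kconv _ x y Kx Ky.
have h01 : 0 <= (2^-1 : R) <= 1 by lra.
have := Kconv x y (Itv01 (proj1 (andP h01)) (proj2 (andP h01))).
rewrite !inE => /(_ Kx Ky) /(KZ 2 _ (ler0n _ 2)).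
rewrite [X in K (_ *: X)](_ : _ = 2^-1 *: x + (1 - 2^-1) *: y) //.
rewrite scalerDr !scalerA mulfV ?pnatr_eq0 // scale1r.
by rewrite (_ : 2 * (1 - 2^-1) = 1 :> R) ?scale1r //; field.
Qed.

Lemma dual_coneZ t a : 0 <= t -> dual_cone K a -> dual_cone K (t *: a).
Proof. by move=> t0 Ka x Kx; rewrite dotZl mulr_ge0 // Ka. Qed.

Lemma dual_cone0 : dual_cone K 0.
Proof. by move=> x _; rewrite dot0l. Qed.

Lemma boundary_dual_coneZ t a : 0 < t -> dual_cone K a ->
  ~ interior (dual_cone K) a -> boundary (dual_cone K) (t *: a).
Proof.
move=> t_gt0 Ka nint; split.
  by apply: subset_closure; apply: dual_coneZ => //; exact: ltW.
move=> Kta; apply: nint; apply: (interior_scale (t := t)) Kta => x.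
move=> /(@dual_coneZ t^-1); rewrite scalerA mulVf ?gt_eqF // scale1r.
by apply; rewrite invr_ge0 ltW.
Qed.

(** From a feasible interior point, a small step along c makes the linear
    constraint strict. *)
Lemma cone_halfspace_slater (c : 'cV[R]_n) (c0 : R) : c != 0 ->
  cone_halfspace K c c0 `&` interior K !=set0 -> exists2 x, K x & c0 < dot c x.
Proof.
move=> c_neq0 [x [[_ cx] /(interior_ray c) Kxc]].
near (0 : R)^'+ => s.
exists (x + s *: c); first by near: s.
rewrite dotDr dotZr (le_lt_trans cx) // ltrDl mulr_gt0 ?dotxx_gt0 //.
Unshelve. all: by end_near. Qed.

(** * Farkas multipliers for one halfspace *)

(** A Farkas certificate that mu >= mu0 holds on the part of K where c >= c0:
    mu = (mu - b c) + b c is at least b c0 there. *)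
Definition multiplier (c : 'cV[R]_n) (c0 : R) (mu : 'cV[R]_n) (mu0 b : R) :=
  [/\ 0 <= b, dual_cone K (mu - b *: c) & mu0 <= b * c0].

Lemma multiplier_valid (c mu : 'cV[R]_n) (c0 mu0 b : R) :
  multiplier c c0 mu mu0 b -> valid_ineq (cone_halfspace K c c0) mu mu0.
Proof.
case=> b0 Kmu mu0b x [Kx cx].
have := Kmu _ Kx; rewrite dotBl dotZl subr_ge0; apply: le_trans.
by apply: (le_trans mu0b); rewrite ler_wpM2l.
Qed.

(** Put f = mu - mu0 and g = c - c0, so that f >= 0 wherever g >= 0 on K. It is
    enough to find b >= 0 with f >= b g on K, because on a cone this bound
    splits into its linear and constant parts. Such a b has to lie below f / g
    where g > 0 and above f / g where g < 0. The infimum b of the first family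
    works, since a convex combination with g = 0 of two points on opposite
    sides compares their ratios; the Slater point makes the family nonempty. *)
Lemma valid_multiplier (c mu : 'cV[R]_n) (c0 mu0 : R) : regular_cone K ->
    (exists2 x, K x & c0 < dot c x) ->
    valid_ineq (cone_halfspace K c c0) mu mu0 ->
  exists b, multiplier c c0 mu mu0 b.
Proof.
move=> Kreg [x0 Kx0 cx0] valid.
pose S := [set r | exists x, [/\ K x, c0 < dot c x &
  r = (dot mu x - mu0) / (dot c x - c0)]].
have S0 : S !=set0 by exists ((dot mu x0 - mu0) / (dot c x0 - c0)), x0.
have lbS : lbound S 0.
  move=> _ [x [Kx cx ->]]; rewrite divr_ge0 // subr_ge0 ?(ltW cx) //.
  by apply: valid; split=> //; exact: ltW.
pose b := inf S.
have lagrange x : K x -> b * (dot c x - c0) <= dot mu x - mu0.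
  move=> Kx; have [cx|cx|cx] := ltgtP c0 (dot c x).
  - rewrite -ler_pdivlMr ?subr_gt0 //; apply: ge_inf; first by exists 0.
    by exists x.
  - rewrite -ler_ndivrMr ?subr_lt0 //; apply: lb_le_inf => // _ [y [Ky cy ->]].
    pose u := dot c y - c0; pose w := c0 - dot c x.
    have u0 : 0 < u by rewrite subr_gt0.
    have w0 : 0 < w by rewrite subr_gt0.
    (* The weights make the constraint c z >= c0 tight. *)
    pose z := (u + w)^-1 *: (u *: x + w *: y).
    have uw0 : 0 < u + w by exact: addr_gt0.
    have Kz : K z.
      apply: regular_coneZ => //; first by rewrite invr_ge0 ltW.
      by apply: regular_coneD => //; apply: regular_coneZ => //; exact: ltW.
    have dotz v : dot v z = (u + w)^-1 * (u * dot v x + w * dot v y).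
      by rewrite dotZr dotDr !dotZr.
    have cz : dot c z = c0.
      rewrite dotz; apply: (mulfI (lt0r_neq0 uw0)).
      by rewrite mulVKf ?gt_eqF // /u /w; ring.
    have /valid : cone_halfspace K c c0 z by split; rewrite // cz.
    rewrite dotz mulrC ler_pdivlMr // => muz.
    rewrite -[dot c x - c0]opprB invrN mulrN -mulNr -/u -/w.
    by rewrite ler_pdivrMr // mulrAC ler_pdivlMr //; lra.
  - by rewrite -cx subrr mulr0 subr_ge0; apply: valid; split; rewrite // cx.
exists b; split.
- exact: lb_le_inf.
- move=> x Kx.
  (* A linear form bounded below on a cone is nonnegative on it: otherwise it
     takes the value e - 1, below its lower bound e, at a multiple of x. *)
  rewrite leNgt; apply/negP => neg.
  pose d := dot mu x - b * dot c x; pose e := mu0 - b * c0.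
  have low t : 0 <= t -> e <= t * d.
    move=> t0; have := lagrange _ (regular_coneZ Kreg t0 Kx).
    by rewrite !dotZr /d /e; lra.
  have e0 : e <= 0 by have := low 0 (lexx _); rewrite mul0r.
  have d0 : d < 0 by move: neg; rewrite dotBl dotZl.
  have t0 : 0 <= (e - 1) / d by rewrite ler_ndivlMr // mul0r; lra.
  by have := low _ t0; rewrite divfK ?lt_eqF //; lra.
- have K0 : K 0 by rewrite -(scale0r x0); exact: regular_coneZ.
  by have := lagrange _ K0; rewrite !dot0r !sub0r mulrN lerN2.
Qed.

Lemma multiplier_le_rhs (c mu : 'cV[R]_n) (c0 mu0 mu1 b : R) :
  mu1 <= b * c0 -> multiplier c c0 mu mu0 b -> multiplier c c0 mu mu1 b.
Proof. by move=> h [? ? _]. Qed.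

(** * Undominated inequalities as unimprovable certificates *)

(** Undominatedness with validity replaced by explicit multipliers, which turns
    each improvement into a choice of numbers: mu, mu0 and the two multipliers
    can be varied separately. *)
Definition unimprovable (c1 : 'cV[R]_n) (c10 : R) (c2 : 'cV[R]_n) (c20 : R)
    (mu : 'cV[R]_n) (mu0 : R) :=
  forall nu nu0 b1 b2, dual_cone K (mu - nu) -> mu0 <= nu0 ->
    multiplier c1 c10 nu nu0 b1 -> multiplier c2 c20 nu nu0 b2 ->
    nu = mu /\ nu0 = mu0.

Lemma unimprovableC (c1 c2 mu : 'cV[R]_n) (c10 c20 mu0 : R) :
  unimprovable c1 c10 c2 c20 mu mu0 -> unimprovable c2 c20 c1 c10 mu mu0.
Proof.
by move=> H nu nu0 b1 b2 Knu le0 m1 m2; exact: (H nu nu0 b2 b1).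
Qed.

Lemma undominated_unimprovable (c1 c2 mu : 'cV[R]_n) (c10 c20 mu0 : R) :
  let C1 := cone_halfspace K c1 c10 in
  let C2 := cone_halfspace K c2 c20 in
  undominated K (closed_convex_hull (C1 `|` C2)) mu mu0 ->
  unimprovable c1 c10 c2 c20 mu mu0.
Proof.
move=> C1 C2 [_ _ undom] nu nu0 b1 b2 Knu le0 m1 m2.
apply: contra_notP undom => ne; exists nu, nu0; split.
  apply/valid_closed_convex_hull => x [|].
  - exact: (multiplier_valid m1).
  - exact: (multiplier_valid m2).
split; first by split; rewrite //= subr_le0.
move=> /= [/subr0_eq e1 /subr0_eq e2]; exact: ne.
Qed.

(** With b1 = 0, the trivial inequality (0, 0), which has multipliers 0, would be
    at least as good as (mu, mu0). *)
Lemma unimprovable_multiplier_gt0 (c1 c2 mu : 'cV[R]_n) (c10 c20 mu0 b1 : R) :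
  unimprovable c1 c10 c2 c20 mu mu0 -> (mu, mu0) <> (0, 0) ->
  multiplier c1 c10 mu mu0 b1 -> 0 < b1.
Proof.
move=> unimp ne [b1_ge0 Kb1 le1]; rewrite lt_neqAle b1_ge0 andbT.
apply/eqP => b1E; subst b1; apply: ne.
move: Kb1 le1; rewrite scale0r mul0r subr0 => Kmu mu0_le0.
have m0 (c : 'cV[R]_n) (c0 : R) : multiplier c c0 0 0 0.
  by split; rewrite // ?scale0r ?subr0 ?mul0r //; exact: dual_cone0.
have [|//|<- <- //] := unimp 0 0 0 0 _ _ (m0 _ _) (m0 _ _).
by rewrite subr0.
Qed.

(** The minimum is the best right-hand side that the multipliers certify. *)
Lemma unimprovable_rhs (c1 c2 mu : 'cV[R]_n) (c10 c20 mu0 b1 b2 : R) :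
  unimprovable c1 c10 c2 c20 mu mu0 ->
  multiplier c1 c10 mu mu0 b1 -> multiplier c2 c20 mu mu0 b2 ->
  Num.min (b1 * c10) (b2 * c20) = mu0.
Proof.
move=> unimp m1 m2.
have [||||_ <- //] := unimp mu (Num.min (b1 * c10) (b2 * c20)) b1 b2.
- by rewrite subrr; exact: dual_cone0.
- by case: m1 m2 => [_ _ l1] [_ _ l2]; rewrite le_min l1 l2.
- by apply: multiplier_le_rhs m1; rewrite ge_min lexx.
- by apply: multiplier_le_rhs m2; rewrite ge_min lexx orbT.
Qed.

(** * Multipliers with residual on the boundary of the dual cone *)

(** If c1 >= c10, then b2 c2 >= b1 c1 >= b1 c10 >= b2 c20 on K. *)
Lemma multiplier_sub_halfspace (c1 c2 : 'cV[R]_n) (c10 c20 b1 b2 : R) : 0 < b2 ->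
  b2 * c20 <= b1 * c10 -> 0 <= b1 -> dual_cone K (b2 *: c2 - b1 *: c1) ->
  cone_halfspace K c1 c10 `<=` cone_halfspace K c2 c20.
Proof.
move=> b2_gt0 le b1_ge0 Kd x [Kx cx]; split=> //.
have := Kd _ Kx; rewrite dotBl !dotZl subr_ge0 => h.
rewrite -(ler_pM2l b2_gt0) (le_trans le) // (le_trans _ h) //.
exact: ler_wpM2l.
Qed.

(** The multipliers b' with mu - b' c in the dual cone are bounded above because
    c is positive somewhere on K, and their supremum is attained because the
    dual cone is defined by weak inequalities. No interior point can lie there,
    as it would allow a larger multiplier. *)
Lemma boundary_crossing (mu c : 'cV[R]_n) b : dual_cone K (mu - b *: c) ->
  (exists2 x, K x & 0 < dot c x) ->
  exists b', [/\ b <= b', dual_cone K (mu - b' *: c) &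
    ~ interior (dual_cone K) (mu - b' *: c)].
Proof.
move=> Kb [x Kx cx].
pose S := [set t | dual_cone K (mu - t *: c)].
have ubS : ubound S (dot mu x / dot c x).
  move=> t /(_ _ Kx); rewrite dotBl dotZl subr_ge0 => h.
  by rewrite ler_pdivlMr.
have hubS : has_ubound S by exists (dot mu x / dot c x).
have bS : b <= sup S by exact: ub_le_sup.
have KS : dual_cone K (mu - sup S *: c).
  move=> y Ky; rewrite dotBl dotZl subr_ge0.
  have [cy|cy] := leP (dot c y) 0.
    have := Kb _ Ky; rewrite dotBl dotZl subr_ge0; apply: le_trans.
    exact: ler_wnM2r.
  rewrite -ler_pdivlMr //; apply: ge_sup; first by exists b.
  move=> t /(_ _ Ky); rewrite dotBl dotZl subr_ge0 => h.
  by rewrite ler_pdivlMr.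
exists (sup S); split=> // /(interior_ray (- c)) far.
near (0 : R)^'+ => s.
have s0 : 0 < s by [].
suff /(ub_le_sup hubS) : S (sup S + s) by rewrite leNgt ltrDl s0.
rewrite /S /= scalerDl opprD addrA -(scalerN s); near: s; exact: far.
Unshelve. all: by end_near. Qed.

(** The second multiplier stays fixed, so a further use with the roles of the two
    halfspaces exchanged puts both residuals outside the interior. *)
Lemma boundary_multiplier (c1 c2 mu : 'cV[R]_n) (c10 c20 mu0 b1 b2 : R) :
  unimprovable c1 c10 c2 c20 mu mu0 -> 0 < b1 -> 0 < b2 ->
  (exists2 x, K x & c10 < dot c1 x) ->
  ~ (cone_halfspace K c1 c10 `<=` cone_halfspace K c2 c20) ->
  multiplier c1 c10 mu mu0 b1 -> multiplier c2 c20 mu mu0 b2 ->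
  exists b, multiplier c1 c10 mu mu0 b /\
    ~ interior (dual_cone K) (mu - b *: c1).
Proof.
move=> unimp b1_gt0 b2_gt0 slater nsub m1 m2.
have minE := unimprovable_rhs unimp m1 m2.
have [b1_ge0 Kb1 le1] := m1; have [b2_ge0 Kb2 le2] := m2.
have [int1|] := pselect (interior (dual_cone K) (mu - b1 *: c1)); last first.
  by exists b1.
set a2 := mu - b2 *: c2 in Kb2.
(* For a2 <> 0, lowering mu by a small multiple of a2 \in K^* keeps both
   residuals in K^*. *)
have a20 : a2 = 0.
  near (0 : R)^'+ => s.
  have s_gt0 : 0 < s by [].
  have s_lt1 : s < 1 by near: s; exact: nbhs_right_lt.
  have [|||/eqP + _] := unimp (mu - s *: a2) mu0 b1 b2 _ (lexx _).
  - by rewrite subKr; apply: dual_coneZ => //; exact: ltW.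
  - split=> //; rewrite addrAC -(scalerN s); near: s; exact: interior_ray.
  - split=> //; rewrite addrAC -/a2 -[X in X - _](scale1r a2) -scalerBl.
    by apply: dual_coneZ; rewrite // subr_ge0 ltW.
  rewrite -subr_eq0 addrAC subrr sub0r oppr_eq0 scaler_eq0 gt_eqF //=.
  by move=> /eqP.
have muE : mu = b2 *: c2 by apply/subr0_eq.
have lt12 : b1 * c10 < b2 * c20.
  rewrite ltNge; apply/negP => le; apply: nsub.
  by apply: (multiplier_sub_halfspace b2_gt0 le) => //; rewrite -muE.
have mu0E : mu0 = b1 * c10 by rewrite -minE min_l // ltW.
have [c10_0|c10_neq0] := eqVneq c10 0.
  have [|b [b1b Kb nint]] := boundary_crossing Kb1; first by rewrite -c10_0.
  exists b; split; last exact: nint.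
  split; [exact: le_trans b1b | exact: Kb |].
  by rewrite mu0E c10_0 !mulr0.
(* A step proportional to c10 increases b1 * c10 by s * c10 ^+ 2, whatever the
   sign of c10. *)
near (0 : R)^'+ => s.
have s_gt0 : 0 < s by [].
pose b := b1 + s * c10.
have Kb : dual_cone K (mu - b *: c1).
  rewrite /b scalerDl opprD addrA -scalerA -(scalerN s).
  by near: s; exact: interior_ray.
have s_small : s * `|c10| <= b1.
  rewrite -ler_pdivlMr ?normr_gt0 //; near: s; apply: nbhs_right_le.
  by rewrite divr_gt0 // normr_gt0.
have b_ge0 : 0 <= b.
  by rewrite /b; have := ler_norm (- c10); rewrite normrN; nra.
have lt_b : mu0 < b * c10.
  rewrite mu0E mulrDl ltrDl -mulrA mulr_gt0 // -expr2 lt_neqAle sqr_ge0.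
  by rewrite eq_sym sqrf_eq0 c10_neq0.
have [||||_ /eqP] := unimp mu (Num.min (b * c10) (b2 * c20)) b b2.
- by rewrite subrr; exact: dual_cone0.
- by rewrite le_min le2 ltW.
- by split; rewrite // ge_min lexx.
- by split; rewrite // ge_min lexx orbT.
by rewrite gt_eqF // lt_min lt_b mu0E.
Unshelve. all: by end_near. Qed.

End Cone.

(** * The form of undominated inequalities *)

Theorem proposition1 (R : realType) (n : nat) (K : set 'cV[R]_n)
    (c1 c2 : 'cV[R]_n) (c10 c20 : R) :
  let C1 := cone_halfspace K c1 c10 in
  let C2 := cone_halfspace K c2 c20 in
  regular_cone K ->
  c10 \in [:: 0; 1; -1] ->
  c20 \in [:: 0; 1; -1] ->
  ~ (C1 `<=` C2) ->
  ~ (C2 `<=` C1) ->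
  C1 `&` interior K !=set0 ->
  C2 `&` interior K !=set0 ->
  forall (mu : 'cV[R]_n) (mu0 : R),
    undominated K (closed_convex_hull (C1 `|` C2)) mu mu0 ->
    exists t : R, [/\ 0 < t, t * mu0 = Num.min c10 c20 &
      exists (a1 a2 : 'cV[R]_n) (b1 b2 : R),
        [/\ t *: mu = a1 + b1 *: c1 /\ t *: mu = a2 + b2 *: c2,
            Num.min (b1 * c10) (b2 * c20) = Num.min c10 c20,
            boundary (dual_cone K) a1 /\ boundary (dual_cone K) a2
          & 0 < b1 /\ 0 < b2]].
Proof.
move=> C1 C2 Kreg c10E c20E n12 n21 int1 int2 mu mu0 undom.
(* For d = 0 the second set is all of K as soon as it is nonempty. *)
have nz c d (c0 d0 : R) : ~ (cone_halfspace K c c0 `<=` cone_halfspace K d d0) ->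
    cone_halfspace K d d0 !=set0 -> d != 0.
  move=> ncd [x [_ dx]]; apply/eqP => d_0; apply: ncd => y [Ky _].
  by split; move: dx; rewrite // d_0 !dot0l.
have ne1 : c1 != 0.
  by apply: nz n21 _; case: int1 => x [C1x _]; exists x.
have ne2 : c2 != 0.
  by apply: nz n12 _; case: int2 => x [C2x _]; exists x.
have slater1 := cone_halfspace_slater ne1 int1.
have slater2 := cone_halfspace_slater ne2 int2.
have unimp := undominated_unimprovable undom.
case: undom => /valid_closed_convex_hull valid mu_neq0 _.
have [b1 m1] : exists b, multiplier K c1 c10 mu mu0 b.
  by apply: valid_multiplier => // x C1x; apply: valid; left.
have [b2 m2] : exists b, multiplier K c2 c20 mu mu0 b.
  by apply: valid_multiplier => // x C2x; apply: valid; right.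
have pos1 b := unimprovable_multiplier_gt0 (b1 := b) unimp mu_neq0.
have pos2 b := unimprovable_multiplier_gt0 (b1 := b) (unimprovableC unimp) mu_neq0.
have [d1 [md1 bd1]] :=
  boundary_multiplier unimp (pos1 _ m1) (pos2 _ m2) slater1 n12 m1 m2.
have [d2 [md2 bd2]] := boundary_multiplier (unimprovableC unimp)
  (pos2 _ m2) (pos1 _ md1) slater2 n21 m2 md1.
have d1_gt0 := pos1 _ md1; have d2_gt0 := pos2 _ md2.
have minE := unimprovable_rhs unimp md1 md2.
have sgE (x : R) : x \in [:: 0; 1; -1] -> Num.sg x = x.
  by rewrite !inE => /or3P[] /eqP ->; rewrite ?sgr0 ?sgr1 ?sgrN1.
have sg_mu0 : Num.sg mu0 = Num.min c10 c20.
  by rewrite -minE sgr_min !sgrM (gtr0_sg d1_gt0) (gtr0_sg d2_gt0) !mul1r !sgE.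
pose t := if mu0 == 0 then 1 else `|mu0|^-1.
have t_gt0 : 0 < t by rewrite /t; case: eqP => // /eqP h; rewrite invr_gt0 normr_gt0.
have tmu0 : t * mu0 = Num.min c10 c20.
  rewrite -sg_mu0 /t; case: eqP => [->|/eqP h]; first by rewrite mulr0 sgr0.
  by rewrite [X in _ * X]numEsg mulrCA mulVf ?mulr1 // normr_eq0.
have bd c b c0 : multiplier K c c0 mu mu0 b ->
    ~ interior (dual_cone K) (mu - b *: c) ->
    boundary (dual_cone K) (t *: (mu - b *: c)).
  by move=> [_ Kb _] nint; apply: boundary_dual_coneZ.
exists t; split=> //.
exists (t *: (mu - d1 *: c1)), (t *: (mu - d2 *: c2)), (t * d1), (t * d2).
split; [|by rewrite -!mulrA -minr_pMr ?(ltW t_gt0) // minE| |].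
- by rewrite -!scalerA -!scalerDr !subrK.
- by split; [exact: bd md1 bd1 | exact: bd md2 bd2].
- by rewrite !mulr_gt0.
Qed.
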